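(* Let $r,s,t\in\mathbb{R}$ with $r\cdot s\cdot t\neq 0$ and $\frac1t=\frac1r+\frac1s$. Then for every positive integer $n$ and all numbers $v_1,\ldots,v_n,x_1,\ldots,x_n\in\mathbb{C}$ with $\prod_{i=1}^n v_i\cdot x_i\neq 0$: (i) if $t<r$ and $t<s$, then $$\left(\sum_{i=1}^n|v_i x_i|^t\right)^{1/t}\le\left(\sum_{i=1}^n|v_i|^r\right)^{1/r}\cdot\left(\sum_{i=1}^n|x_i|^s\right)^{1/s};$$ (ii) if $t>r$ and $t>s$, then $$\left(\sum_{i=1}^n|v_i x_i|^t\right)^{1/t}\ge\left(\sum_{i=1}^n|v_i|^r\right)^{1/r}\cdot\left(\sum_{i=1}^n|x_i|^s\right)^{1/s}.$$
   Context: All exponents are real and all bases are positive real numbers, so the powers have their usual meaning. *)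

(* Defs.v *)
(* For [z : R[i]], the library's [`|z|] lives in [R[i]]; [normc z : R] is the same
   modulus as a real number, so that real powers [`^] apply to it. *)
From mathcomp Require Export all_boot all_order all_algebra.
From mathcomp Require Export all_classical all_reals all_analysis.
From mathcomp Require Export complex.
Export ComplexField.Normc.

Set Implicit Arguments.
Unset Strict Implicit.
Unset Printing Implicit Defensive.

(* Main.v *)
(* With p = t / r and q = t / s one has p + q = 1 and, setting f = |v|^r and
   g = |x|^s, |v x|^t = f^p g^q. Hölder's inequality compares sum f^p g^q with
   (sum f)^p (sum g)^q: "<=" if p, q > 0, and ">=" if p and q have opposite
   signs. Since p q = t (r - t) / r^2, the direction is determined by the signs
   of t and r - t, and raising to the power 1 / t flips it when t < 0. *)
Require Import Defs.
From mathcomp Require Import ring lra.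
Import Order.TTheory GRing.Theory Num.Theory.
Local Open Scope ring_scope.
Local Open Scope complex_scope.

(** Young's inequality for the conjugate exponents [p^-1] and [q^-1], applied to [a]^ p[and]b
    [^ q]. *)
Lemma young_weighted (R : realType) (p q a b : R) :
  0 < p -> 0 < q -> p + q = 1 -> 0 <= a -> 0 <= b ->
  a `^ p * b `^ q <= p * a + q * b.
Proof.
move=> p0 q0 pq1 a0 b0.
have := @conjugate_powR R (a `^ p) (b `^ q) p^-1 q^-1 (powR_ge0 _ _)
  (powR_ge0 _ _).
rewrite !invrK !invr_gt0 -!powRrM !divff ?gt_eqF// !powRr1//.
by rewrite (mulrC p) (mulrC q); apply.
Qed.

(** By homogeneity both sums can be scaled to 1; weighted Young then bounds each term, and the
    bounds add up to [p + q = 1]. *)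
Lemma hoelder_sum (R : realType) (I : finType) (f g : I -> R) (p q : R) :
  (forall i, 0 <= f i) -> (forall i, 0 <= g i) ->
  0 < p -> 0 < q -> p + q = 1 ->
  \sum_i f i `^ p * g i `^ q <= (\sum_i f i) `^ p * (\sum_i g i) `^ q.
Proof.
move=> f0 g0 p0 q0 pq1.
set A := \sum_i f i; set B := \sum_i g i.
have A0 : 0 <= A by apply: sumr_ge0.
have B0 : 0 <= B by apply: sumr_ge0.
(* A vanishing sum cannot be divided by, but it forces every term of a nonnegative family to be 0,
   so the left side vanishes. *)
have [AE|An0] := eqVneq A 0.
  rewrite big1 ?mulr_ge0 ?powR_ge0// => i _.
  by rewrite (psumr_eq0P (fun i _ => f0 i) AE)// powR0 ?gt_eqF// mul0r.
have [BE|Bn0] := eqVneq B 0.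
  rewrite big1 ?mulr_ge0 ?powR_ge0// => i _.
  by rewrite (psumr_eq0P (fun i _ => g0 i) BE)// powR0 ?gt_eqF// mulr0.
have {A0}A0 : 0 < A by rewrite lt_def An0.
have {B0}B0 : 0 < B by rewrite lt_def Bn0.
have scaled i : f i `^ p * g i `^ q =
    A `^ p * B `^ q * ((f i / A) `^ p * (g i / B) `^ q).
  rewrite mulrACA -!powRM ?divr_ge0 ?(ltW A0) ?(ltW B0)//.
  by rewrite (mulrC A) (mulrC B) !divfK.
rewrite (eq_bigr _ (fun i _ => scaled i)) -mulr_sumr.
rewrite ler_piMr ?mulr_ge0 ?powR_ge0//.
apply: (@le_trans _ _ (\sum_i (p * (f i / A) + q * (g i / B)))).
  by apply: ler_sum => i _; rewrite young_weighted// divr_ge0// ltW.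
by rewrite big_split/= -!mulr_sumr -!mulr_suml !divff// !mulr1 pq1.
Qed.

(** When [p < 0 < q], this is ordinary Hölder solved for the sum of the products: it bounds the sum
    of [g], and the factor with exponent [- p] is then moved across. *)
Lemma reverse_hoelder_sum (R : realType) (I : finType) (f g : I -> R)
    (p q : R) :
  (forall i, 0 < f i) -> (forall i, 0 < g i) ->
  p * q < 0 -> p + q = 1 ->
  (\sum_i f i) `^ p * (\sum_i g i) `^ q <= \sum_i f i `^ p * g i `^ q.
Proof.
wlog p0 : f g p q / p < 0 => [hwlog f0 g0 pq0 pq1|].
  have [p0|p0] := ltP p 0; first exact: hwlog.
  rewrite mulrC (eq_bigr _ (fun i _ => mulrC (f i `^ p) (g i `^ q))).
  by apply: hwlog => //; [nra | rewrite mulrC | rewrite addrC].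
move=> f0 g0 _ pq1.
have q0 : 0 < q by lra.
have qn0 : q != 0 by rewrite gt_eqF.
have pn0 : p != 0 by rewrite lt_eqF.
set A := \sum_i f i; set B := \sum_i g i; set C := \sum_i f i `^ p * _.
(* This covers an empty [I]: by convention 0 to the nonzero power [p] is 0, even for negative
   [p]. *)
have [->|An0] := eqVneq A 0.
  by rewrite powR0// mul0r sumr_ge0// => i _; rewrite mulr_ge0 ?powR_ge0.
have C0 : 0 <= C by apply: sumr_ge0 => i _; rewrite mulr_ge0 ?powR_ge0.
have B0 : 0 <= B by apply: sumr_ge0 => i _; exact: ltW.
(* g = (f^p g^q)^(1/q) f^(-p/q), with positive weights 1/q and -p/q *)
have BC : B <= C `^ q^-1 * A `^ (- p / q).
  have gE i : g i = (f i `^ p * g i `^ q) `^ q^-1 * f i `^ (- p / q).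
    rewrite powRM ?powR_ge0// -!powRrM divff// powRr1 ?ltW//.
    rewrite mulrAC -powRD ?(gt_eqF (f0 i)) ?implybT//.
    by rewrite mulNr subrr powRr0 mul1r.
  rewrite /B (eq_bigr _ (fun i _ => gE i)); apply: hoelder_sum.
  - by move=> i; rewrite mulr_ge0 ?powR_ge0.
  - by move=> i; exact: ltW.
  - by rewrite invr_gt0.
  - by rewrite divr_gt0 ?oppr_gt0.
  (* Writing [q] as [- p + 1] turns the sum of the weights into an identity in [p] alone. *)
  - by rewrite -(addKr p q) pq1; field; rewrite -pq1 addKr.
have : B `^ q <= C * A `^ (- p).
  apply: (@le_trans _ _ ((C `^ q^-1 * A `^ (- p / q)) `^ q)).
    by apply: ge0_ler_powR; rewrite ?nnegrE ?mulr_ge0 ?powR_ge0 ?(ltW q0).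
  by rewrite powRM ?powR_ge0// -!powRrM divfK// mulVf// powRr1.
have A0 : 0 < A.
  by rewrite lt_def An0 sumr_ge0// => i _; exact: ltW.
by rewrite powRN ler_pdivlMr ?powR_gt0// mulrC.
Qed.

Lemma le0_ger_powR (R : realType) (x y c : R) :
  c <= 0 -> 0 < x -> x <= y -> y `^ c <= x `^ c.
Proof.
move=> c0 x0 xy; have y0 := lt_le_trans x0 xy.
rewrite -(opprK c) !(powRN _ (- c)) lef_pV2 ?posrE ?powR_gt0//.
by apply: ge0_ler_powR; rewrite ?nnegrE ?oppr_ge0 ?(ltW x0) ?(ltW y0).
Qed.

Lemma gt0_mul_sum1 (R : realDomainType) (p q : R) :
  0 < p * q -> p + q = 1 -> 0 < p /\ 0 < q.
Proof. by move=> pq0 pq1; split; nra. Qed.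

Theorem corollary2 (R : realType) (r s t : R)
    (hrst : r * s * t != 0) (ht : t^-1 = r^-1 + s^-1)
    (n : nat) (hn : (0 < n)%N) (v x : 'I_n -> R[i])
    (hvx : \prod_(i < n) (v i * x i) != 0) :
  (t < r -> t < s ->
     (\sum_(i < n) normc (v i * x i) `^ t) `^ t^-1 <=
     (\sum_(i < n) normc (v i) `^ r) `^ r^-1 *
     (\sum_(i < n) normc (x i) `^ s) `^ s^-1) /\
  (r < t -> s < t ->
     (\sum_(i < n) normc (v i) `^ r) `^ r^-1 *
     (\sum_(i < n) normc (x i) `^ s) `^ s^-1 <=
     (\sum_(i < n) normc (v i * x i) `^ t) `^ t^-1).
Proof.
have normc_gt0 (z : R[i]) : z != 0 -> 0 < normc z.
  move=> z0; rewrite lt_def; apply/andP; split.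
    by apply: contra_neq z0; exact: eq0_normc.
  by case: (z) => a b; exact: sqrtr_ge0.
(* Strict positivity needs an index, which [hn] supplies; it matters because negative powers are
   decreasing only on positive bases. *)
have sum_gt0 (F : 'I_n -> R) : (forall i, 0 < F i) -> 0 < \sum_i F i.
  move=> F0; rewrite (bigD1 (Ordinal hn))//= ltr_pwDl// sumr_ge0// => i _.
  exact: ltW.
have vx0 i : v i * x i != 0 by move/prodf_neq0: hvx => /(_ i isT).
have v0 i : 0 < normc (v i).
  by apply: normc_gt0; have := vx0 i; rewrite mulf_eq0 negb_or => /andP[].
have x0 i : 0 < normc (x i).
  by apply: normc_gt0; have := vx0 i; rewrite mulf_eq0 negb_or => /andP[].
have [rn0 sn0 tn0] : [/\ r != 0, s != 0 & t != 0].
  by move: hrst; rewrite !mulf_eq0 !negb_or => /andP[/andP[]].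
pose f i := normc (v i) `^ r; pose g i := normc (x i) `^ s.
have f0 i : 0 < f i by rewrite powR_gt0.
have g0 i : 0 < g i by rewrite powR_gt0.
have CE : \sum_(i < n) normc (v i * x i) `^ t =
    \sum_i f i `^ (t / r) * g i `^ (t / s).
  apply: eq_bigr => i _.
  by rewrite normcM powRM ?ltW// -!powRrM (mulrC r) (mulrC s) !divfK.
(* Since [r^-1 = (t / r) * t^-1], and likewise for [s], both sides become powers with the same outer
   exponent [t^-1]. *)
have ABE A B :
    A `^ r^-1 * B `^ s^-1 = (A `^ (t / r) * B `^ (t / s)) `^ t^-1.
  rewrite powRM ?powR_ge0// -!powRrM.
  by rewrite (mulrAC t r^-1) (mulrAC t s^-1) divff// !mul1r.
have pq1 : t / r + t / s = 1 by rewrite -mulrDr -ht divff.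
(* The second factor is [1 - t / r]. *)
have pqE : t / r * (t / s) = t * (r - t) / r ^+ 2.
  by rewrite -(addKr (t / r) (t / s)) pq1; field.
rewrite CE ABE; move: pq1 pqE; set p := t / r; set q := t / s => pq1 pqE.
have r2 : 0 < (r ^+ 2)^-1 by rewrite invr_gt0 exprn_even_gt0.
have fg_gt0 i : 0 < f i `^ p * g i `^ q by rewrite mulr_gt0 ?powR_gt0.
have AB_gt0 : 0 < (\sum_i f i) `^ p * (\sum_i g i) `^ q.
  by rewrite mulr_gt0 ?powR_gt0 ?sum_gt0.
have hoelder_pos : 0 < t * (r - t) ->
    \sum_i f i `^ p * g i `^ q <= (\sum_i f i) `^ p * (\sum_i g i) `^ q.
  move=> tr; have pq0 : 0 < p * q by rewrite pqE mulr_gt0.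
  have [p0 q0] := gt0_mul_sum1 _ _ _ pq0 pq1.
  by apply: hoelder_sum => // i; exact: ltW.
have hoelder_neg : t * (r - t) < 0 ->
    (\sum_i f i) `^ p * (\sum_i g i) `^ q <= \sum_i f i `^ p * g i `^ q.
  by move=> tr; apply: reverse_hoelder_sum => //; rewrite pqE nmulr_rlt0.
have root_le y z : 0 < t -> 0 < y -> y <= z -> y `^ t^-1 <= z `^ t^-1.
  move=> /ltW t0 y0 yz.
  apply: ge0_ler_powR; rewrite ?nnegrE ?invr_ge0 ?(ltW y0)//.
  exact: le_trans (ltW y0) yz.
have root_ge y z : t < 0 -> 0 < y -> y <= z -> z `^ t^-1 <= y `^ t^-1.
  by move=> t0; apply: le0_ger_powR; rewrite invr_le0 ltW.
(* In each half, [t < 0] comes first. In (i) it pairs reverse Hölder with a decreasing root, and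
   [t > 0] pairs Hölder with an increasing one; in (ii) the two Hölder inequalities swap. *)
split=> tr _; have [t0|t0|/eqP] := ltgtP t 0; rewrite ?(negbTE tn0)//.
- by apply: root_ge => //; apply: hoelder_neg; rewrite nmulr_rlt0// subr_gt0.
- apply: root_le => //; first exact: sum_gt0.
  by apply: hoelder_pos; rewrite mulr_gt0// subr_gt0.
- apply: root_ge => //; first exact: sum_gt0.
  by apply: hoelder_pos; rewrite nmulr_rgt0// subr_lt0.
- by apply: root_le => //; apply: hoelder_neg; rewrite pmulr_rlt0// subr_lt0.
Qed.
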